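(* Let $X$ be a Hilbert space and let $\mathcal{H}$ be a locally finite weight in $X$ with corresponding subspaces $(X_n)_{n\in\mathbb{N}}$, and let $P_n\in L(X)$ be the orthogonal projection onto $X_n$. Let $H\colon D(H)\subseteq X\to X$ be linear and densely defined with $P_nH\subseteq HP_n$ for every $n\in\mathbb{N}$. Then the following conditions are equivalent. (i) $H$ is essentially skew-self-adjoint in $X$. (ii) $H\mathcal{H}$ is essentially skew-self-adjoint in $X_{\mathcal{H}}$.
   Context: An operator $K$ is essentially skew-self-adjoint if it is closable and $\overline{K}$ is skew-self-adjoint, i.e. $\overline{K}^{\star}=-\overline{K}$. A self-adjoint operator $\mathcal{H}$ in $X$ is a locally finite weight if there is an increasing sequence $(X_n)_{n\in\mathbb{N}}$ of closed subspaces of $X$ (the corresponding subspaces) such that (a) for every $n$, $X_n\subseteq D(\mathcal{H})$, $\mathcal{H}$ maps $X_n$ into $X_n$, and $\mathcal{H}_n\colon X_n\to X_n$, $x\mapsto\mathcal{H}x$, is bounded with $\mathcal{H}_n\geqslant c_n>0$ (in the sense of positive definiteness) for some constant $c_n$; (b) $\mathcal{H}|_{\bigcup_{n}X_n}$ is essentially self-adjoint in $X$. $X_{\mathcal{H}}$ denotes the completion of $\bigcup_{n}X_n$ with respect to the scalar product $\langle\cdot,\mathcal{H}\cdot\rangle_X$; its elements are represented by Cauchy sequences in $(\bigcup_nX_n,\langle\cdot,\mathcal{H}\cdot\rangle)$. The map $P\colon D(\mathcal{H})\to X_{\mathcal{H}}$, $Px=(P_nx)_{n\in\mathbb{N}}$,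 is well defined and injective. The operator $H\mathcal{H}\colon D(H\mathcal{H})\subseteq X_{\mathcal{H}}\to X_{\mathcal{H}}$ is defined by $$D(H\mathcal{H})=\{\tilde{x}\in X_{\mathcal{H}}:\exists\,x\in D(\mathcal{H})\colon Px=\tilde{x},\ \mathcal{H}x\in D(H)\text{ and }(P_nH\mathcal{H}x)_{n\in\mathbb{N}}\in X_{\mathcal{H}}\},\quad H\mathcal{H}\tilde{x}=(P_nH\mathcal{H}x)_{n\in\mathbb{N}},$$ where ''$(P_nH\mathcal{H}x)_n\in X_{\mathcal{H}}$'' means that this sequence is Cauchy in $(\bigcup_nX_n,\langle\cdot,\mathcal{H}\cdot\rangle)$. *)

(* Defs.v *)
From HB Require Import structures.
From mathcomp Require Export all_boot all_order all_algebra.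
From mathcomp Require Export sesquilinear complex.
From mathcomp Require Export boolp classical_sets functions reals.
From mathcomp Require Export topology normedtype.
Export numFieldNormedType.Exports.

Set Implicit Arguments.
Unset Strict Implicit.
Unset Printing Implicit Defensive.

Import Order.TTheory GRing.Theory Num.Theory.
Local Open Scope classical_set_scope.
Local Open Scope ring_scope.

(* "Hilbert space" covers both real and complex scalars: every statement is
   made for an arbitrary [F], with scalar field [scalars R F]. *)
Variant scalar_kind := RealScalars | ComplexScalars.

Definition scalars (R : realType) (F : scalar_kind) : numFieldType :=
  match F with
  | RealScalars => R : numFieldType
  | ComplexScalars => R[i] : numFieldType
  end.

Definition scalar_conj (R : realType) (F : scalar_kind) :
    {rmorphism scalars R F -> scalars R F} :=
  match F with
  | RealScalars => (idfun : {rmorphism R -> R})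
  | ComplexScalars => (conjc : {rmorphism R[i] -> R[i]})
  end.

(* The inner product [dotp] is linear in its first argument. *)
HB.mixin Record CompleteNormedModule_isHilbert (R : realType) (F : scalar_kind)
    X of CompleteNormedModule (scalars R F) X := {
  dotp : {dot X for scalar_conj R F} ;
  sqr_normE : forall x : X, `|x| ^+ 2 = dotp x x
}.

#[short(type="hilbertType")]
HB.structure Definition Hilbert (R : realType) (F : scalar_kind) :=
  {X of CompleteNormedModule_isHilbert R F X
      & CompleteNormedModule (scalars R F) X}.

(* A (possibly unbounded) linear operator in X is identified with its graph,
   a subset of X * X. *)
Section operators.
Context (R : realType) (F : scalar_kind) (X : hilbertType R F).
Implicit Types A : set (X * X).

Definition graph (f : X -> X) : set (X * X) := range (fun x => (x, f x)).

Definition dom A : set X := fst @` A.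

Definition linear_operator A :=
  submod_closed [in A] /\ forall x y z, A (x, y) -> A (x, z) -> y = z.

Definition adjoint A : set (X * X) :=
  [set p | forall q, A q -> dotp q.2 p.1 = dotp q.1 p.2].

Definition opp_operator A : set (X * X) := [set p | A (p.1, - p.2)].

Definition restrict A (S : set X) : set (X * X) := [set p | A p /\ S p.1].

Definition self_adjoint A :=
  [/\ linear_operator A, dense (dom A) & adjoint A = A].

Definition skew_self_adjoint A :=
  [/\ linear_operator A, dense (dom A) & adjoint A = opp_operator A].

Definition closable A := linear_operator (closure A).

Definition essentially_self_adjoint A :=
  closable A /\ self_adjoint (closure A).

Definition essentially_skew_self_adjoint A :=
  closable A /\ skew_self_adjoint (closure A).

Definition closed_subspace (S : set X) := submod_closed [in S] /\ closed S.

Definition orthogonal_projection (S : set X) (P : X -> X) :=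
  forall x, S (P x) /\ forall y, S y -> dotp (x - P x) y = 0.

(* [W] is a locally finite weight with corresponding subspaces [Xs]. *)
Record locally_finite_weight (W : set (X * X)) (Xs : nat -> set X) : Prop := {
  lfw_self_adjoint : self_adjoint W ;
  lfw_closed_subspace : forall n, closed_subspace (Xs n) ;
  lfw_increasing : forall m n, (m <= n)%N -> Xs m `<=` Xs n ;
  lfw_invariant : forall n x, Xs n x -> exists2 y, W (x, y) & Xs n y ;
  lfw_bounded : forall n, exists M : scalars R F,
    forall x y, Xs n x -> W (x, y) -> `|y| <= M * `|x| ;
  lfw_positive : forall n, exists2 c : scalars R F, 0 < c &
    forall x y, Xs n x -> W (x, y) -> c * dotp x x <= dotp x y ;
  lfw_core : essentially_self_adjoint (restrict W (\bigcup_n Xs n))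
}.

End operators.

Section weighted_space.
Context (R : realType) (F : scalar_kind) (X XW : hilbertType R F).
Implicit Types (W H : set (X * X)) (U : set X) (J : X -> XW).

(* The Hilbert space [XW] is the completion, along the canonical embedding [J],
   of the subspace [U] endowed with the inner product <., W .>; the values of
   [J] outside [U] are irrelevant. This characterizes (XW, J) up to a unique
   unitary isomorphism. *)
Record is_completion W U J : Prop := {
  completion_linear : forall (a : scalars R F) x y, U x -> U y ->
    J (a *: x + y) = a *: J x + J y ;
  completion_isometry : forall x y z, U x -> U y -> W (y, z) ->
    dotp (J x) (J y) = dotp x z ;
  completion_dense : dense (J @` U)
}.

(* The element [xi] of the completion is the class of the sequence [u] of
   elements of [U]. As [J] is isometric and [XW] complete, [u] represents some
   [xi] iff it is Cauchy for <., W .>. *)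
Definition represents U J (u : nat -> X) (xi : XW) :=
  (forall n, U (u n)) /\ J \o u @ \oo --> xi.

(* The operator H W in the completion [XW]. *)
Definition weighted_operator W (Xs : nat -> set X) (P : nat -> X -> X) H J :
    set (XW * XW) :=
  let U := \bigcup_n Xs n in
  [set p | exists x y, [/\ (H \; W)%relation (x, y),
     represents U J (P ^~ x) p.1 & represents U J (P ^~ y) p.2]].

End weighted_space.

(* Main.v *)
(* The projections [P n] reduce [H]: the operator, its closure and its adjoint
   are all stable under [P n x P n], so that [H] is essentially skew-self-adjoint
   iff each of its parts in [X_n] is. As [W] commutes with [P n], the orthogonal
   projections onto the subspaces [J X_n] of the completion extend the [P n] and
   reduce [H W] in the same way. On [X_n] the weight [W] is a bounded bijection
   with bounded inverse and [J] is an isomorphism onto [J X_n], and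
   [(J p, J q) |-> (W p, q)] carries both the graph of the part of [H W] and that
   of its adjoint to those of [H], since <J q, J p> = <q, W p>. *)

Require Import Defs.
From mathcomp Require Import ring.

Set Implicit Arguments.
Unset Strict Implicit.
Unset Printing Implicit Defensive.

Import Order.TTheory GRing.Theory Num.Theory.
Local Open Scope classical_set_scope.
Local Open Scope ring_scope.

(** * Inner products over real or complex scalars *)

Section inner_product.
Context (R : realType) (F : scalar_kind) (X : hilbertType R F).
Local Notation K := (scalars R F).
Implicit Types (x y z : X) (a : K).

Lemma dotpDl x y z : dotp (x + y) z = dotp x z + dotp y z.
Proof. exact: linearDl. Qed.

Lemma dotpBl x y z : dotp (x - y) z = dotp x z - dotp y z.
Proof. exact: linearBl. Qed.

Lemma dotpDr x y z : dotp z (x + y) = dotp z x + dotp z y.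
Proof. exact: linearDr. Qed.

Lemma dotpBr x y z : dotp z (x - y) = dotp z x - dotp z y.
Proof. exact: linearBr. Qed.

Lemma dotpNr x y : dotp x (- y) = - dotp x y.
Proof. exact: linearNr. Qed.

Lemma dotpZl a x y : dotp (a *: x) y = a * dotp x y.
Proof. exact: linearZl_LR. Qed.

Lemma dotpZr a x y : dotp x (a *: y) = scalar_conj R F a * dotp x y.
Proof. exact: linearZr_LR. Qed.

Lemma dotpC x y : dotp x y = scalar_conj R F (dotp y x).
Proof. by rewrite hermC expr0 mul1r. Qed.

Lemma dotp0l x : dotp 0 x = 0.
Proof. exact: linear0l. Qed.

Lemma scalar_conjM a : scalar_conj R F a * a = `|a| ^+ 2.
Proof.
by case: F a => /= a; [rewrite real_normK ?num_real | rewrite mulrC sqr_normc].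
Qed.

Lemma scalar_archi a : 0 <= a -> exists n, a < n%:R.
Proof.
case: F a => /= a a0; first by exists (Num.bound a); exact: archi_boundP.
case: a a0 => u v; rewrite lecE /= => /andP[/eqP -> u0].
exists (Num.bound u).
have -> : (Num.bound u)%:R = ((Num.bound u)%:R%:C)%C :> R[i].
  by rewrite (rmorph_nat (real_complex R)).
by rewrite ltcR archi_boundP.
Qed.

Lemma dotp_eq x y : (forall z, dotp z x = dotp z y) -> x = y.
Proof.
move=> xy; apply/eqP; rewrite -subr_eq0 -normr_eq0 -sqrf_eq0 sqr_normE dotpBr.
by rewrite xy subrr.
Qed.

Lemma CauchySchwarz_dotp x y : `|dotp x y| <= `|x| * `|y|.
Proof.
have [->|y0] := eqVneq y 0.
  by rewrite normr0 mulr0 dotpC dotp0l rmorph0 normr0.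
set b := `|y| ^+ 2; set a := dotp x y.
have b_gt0 : 0 < b by rewrite exprn_gt0 ?normr_gt0.
have bE : dotp y y = b by rewrite /b sqr_normE.
have cb : scalar_conj R F b = b by rewrite -bE -dotpC.
(* The square expands to [b (b |x|^2 - |a|^2)], and the factor [b > 0] cancels. *)
have : 0 <= `|b *: x - a *: y| ^+ 2 by rewrite exprn_ge0.
rewrite sqr_normE !(dotpBl, dotpBr, dotpZl, dotpZr) bE cb -/a (dotpC y x) -/a.
rewrite [b * scalar_conj R F a]mulrC subrr subr0 -mulrBr.
rewrite scalar_conjM -sqr_normE pmulr_rge0 // subr_ge0 /b -exprMn => le2.
by rewrite -(@ler_pXn2r _ 2) ?nnegrE ?mulr_ge0 // mulrC.
Qed.

(** Serves to divide a Cauchy-Schwarz bound on [|x|^2] by [|x|] without excluding [x = 0]. *)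
Lemma le_norm_of_sqr x (c : K) : 0 <= c ->
  `|x| ^+ 2 <= `|x| * c -> `|x| <= c.
Proof.
by have [->|x0] := eqVneq x 0; rewrite ?normr0 // expr2 ler_pM2l // normr_gt0.
Qed.

End inner_product.

(** * Closure and density in terms of distances *)

Section epsilons.
Context (K : numFieldType).

Lemma closure_pairP (V : normedModType K) (A : set (V * V)) x y :
  closure A (x, y) <-> forall e : K, 0 < e ->
    exists a b, [/\ A (a, b), `|x - a| < e & `|y - b| < e].
Proof.
split=> [Axy e e0|Axy B /nbhs_ballP[e /= e0 eB]].
  have [[a b] [Aab [/=]]] := Axy _ (nbhsx_ballx (x, y) e e0).
  by rewrite -!ball_normE; exists a, b.
have [a [b [Aab xa yb]]] := Axy e e0; exists (a, b); split=> //; apply: eB.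
by split; rewrite -ball_normE.
Qed.

Lemma denseP (V : normedModType K) (A : set V) :
  dense A <-> forall x (e : K), 0 < e -> exists2 a, A a & `|x - a| < e.
Proof.
split=> [dA x e e0|dA O [x Ox] oO].
  have [||a [xa Aa]] := dA (ball x e); first by exists x; exact: ballxx.
    exact: ball_open.
  by exists a => //; move: xa; rewrite -ball_normE.
have [e /= e0 eO] := (nbhs_ballP _ _).1 (open_nbhs_nbhs (conj oO Ox)).
by have [a Aa xa] := dA x e e0; exists a; split=> //; apply: eO; rewrite -ball_normE.
Qed.

Lemma norm_eps0 (V : normedModType K) (C : K) (x : V) : 0 <= C ->
  (forall e : K, 0 < e -> `|x| <= C * e) -> x = 0.
Proof.
move=> C0 xC; have [//|x0] := eqVneq x 0.
(* [C] may be zero, hence the denominator [C + 1] in the choice of [e]. *)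
have C1 : 0 < C + 1 by rewrite ltr_wpDl.
have := xC (`|x| / (C + 1)); rewrite divr_gt0 ?normr_gt0 // => /(_ isT).
rewrite mulrA ler_pdivlMr // [C * _]mulrC ler_pM2l ?normr_gt0 //.
by rewrite gerDl ler10.
Qed.

End epsilons.

(** * Linear subspaces *)

Section submodules.
Context (K : numFieldType) (V : lmodType K) (S : set V).
Hypothesis subS : submod_closed [in S].

Lemma submod0 : S 0.
Proof. by have [] := subS; rewrite !inE. Qed.

Lemma submodP (a : K) x y : S x -> S y -> S (a *: x + y).
Proof. by move=> Sx Sy; have [_ /(_ a x y)] := subS; rewrite !inE; apply. Qed.

Lemma submodB x y : S x -> S y -> S (x - y).
Proof. by move=> Sx Sy; rewrite -scaleN1r addrC; apply: submodP. Qed.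

Lemma submodN x : S x -> S (- x).
Proof. by move=> Sx; rewrite -sub0r; apply: submodB => //; exact: submod0. Qed.

End submodules.

(** * Orthogonal projections *)

Section orthogonal_projections.
Context (R : realType) (F : scalar_kind) (X : hilbertType R F).
Local Notation K := (scalars R F).
Context (S : set X) (P : X -> X).
Hypotheses (subS : submod_closed [in S]) (projP : orthogonal_projection S P).

Lemma proj_in x : S (P x).
Proof. by have [] := projP x. Qed.

Lemma proj_orth x y : S y -> dotp (x - P x) y = 0.
Proof. by have [_] := projP x; apply. Qed.

(** [P x - q] lies in [S] and is a difference of two vectors orthogonal to [S], so it is orthogonal
    to itself. *)
Lemma proj_uniq x q : S q -> (forall y, S y -> dotp (x - q) y = 0) -> P x = q.
Proof.
move=> Sq qx; apply/eqP; rewrite -subr_eq0 -normr_eq0 -sqrf_eq0 sqr_normE.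
have SPq : S (P x - q) by apply: submodB => //; exact: proj_in.
have E : P x - q = (x - q) - (x - P x) by rewrite opprB [RHS]addrC addrA subrK.
by rewrite {1}E dotpBl qx // proj_orth // subrr.
Qed.

Lemma proj_id x : S x -> P x = x.
Proof. by move=> Sx; apply: proj_uniq => // y _; rewrite subrr dotp0l. Qed.

Lemma proj_linear (a : K) x y : P (a *: x + y) = a *: P x + P y.
Proof.
apply: proj_uniq => [|z Sz]; first by apply: submodP => //; exact: proj_in.
by rewrite opprD addrACA -scalerBr dotpDl dotpZl !proj_orth // mulr0 addr0.
Qed.

Lemma projB x y : P (x - y) = P x - P y.
Proof. by rewrite addrC -scaleN1r proj_linear scaleN1r addrC. Qed.

Lemma projN x : P (- x) = - P x.
Proof. by rewrite -[- x]sub0r projB (proj_id (submod0 subS)) sub0r. Qed.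

Lemma dotp_projl x y : S y -> dotp (P x) y = dotp x y.
Proof.
by move=> Sy; apply/esym/eqP; rewrite -subr_eq0 -dotpBl proj_orth.
Qed.

Lemma proj_sym x y : dotp (P x) y = dotp x (P y).
Proof.
rewrite dotpC -dotp_projl; last exact: proj_in.
by rewrite -dotpC dotp_projl //; exact: proj_in.
Qed.

(** By orthogonality and Cauchy-Schwarz, [|P x|^2 = <x, P x> <= |x| |P x|]. *)
Lemma proj_norm x : `|P x| <= `|x|.
Proof.
apply: le_norm_of_sqr => //; rewrite mulrC sqr_normE.
rewrite dotp_projl; last exact: proj_in.
apply: le_trans (CauchySchwarz_dotp _ _).
(* Scalars may be complex: [<x, P x>] is below its modulus because it is real, being equal to
   [|P x|^2]. *)
by rewrite real_ler_norm // -(dotp_projl x (proj_in x)) -sqr_normE realX.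
Qed.

(** As [P x - s] lies in [S], [|x - P x|^2 = <x - P x, x - s>], to which Cauchy-Schwarz applies. *)
Lemma proj_best x s : S s -> `|x - P x| <= `|x - s|.
Proof.
move=> Ss; apply: le_norm_of_sqr => //; rewrite sqr_normE.
have E : dotp (x - P x) (x - P x) = dotp (x - P x) (x - s).
  rewrite [in RHS](_ : x - s = (x - P x) + (P x - s)); last by rewrite addrA subrK.
  by rewrite [RHS]dotpDr (proj_orth x (submodB subS (proj_in x) Ss)) addr0.
apply: le_trans (CauchySchwarz_dotp _ _); rewrite -E.
by rewrite real_ler_norm // -sqr_normE realX.
Qed.

End orthogonal_projections.

(** * Adjoints and closures of operators *)

Section operators.
Context (R : realType) (F : scalar_kind) (X : hilbertType R F).
Local Notation K := (scalars R F).
Implicit Types A : set (X * X).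

Lemma dotp_distr (x y z : X) (e : K) : `|y - z| < e ->
  `|dotp x y - dotp x z| <= `|x| * e.
Proof.
move=> yz; rewrite -dotpBr; apply: le_trans (CauchySchwarz_dotp _ _) _.
by rewrite ler_wpM2l // ltW.
Qed.

Lemma dotp_distl (x y z : X) (e : K) : `|y - z| < e ->
  `|dotp y x - dotp z x| <= `|x| * e.
Proof.
move=> yz; rewrite -dotpBl; apply: le_trans (CauchySchwarz_dotp _ _) _.
by rewrite mulrC ler_wpM2l // ltW.
Qed.

(** The inner product is continuous, so each equation defining the adjoint is a closed condition on
    the pair. *)
Lemma closure_adjoint A : closure (adjoint A) = adjoint A.
Proof.
apply/seteqP; split=> [[x y] /closure_pairP clxy q Aq /=|]; last first.
  exact: subset_closure.
apply/eqP; rewrite -subr_eq0; apply/eqP.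
apply: (@norm_eps0 _ _ (`|q.2| + `|q.1|)) => [|e e0]; first exact: addr_ge0.
have [a [b [/(_ _ Aq) /= abE xa yb]]] := clxy _ e0.
rewrite -(subrKA (dotp q.2 a)) mulrDl; apply: le_trans (ler_normD _ _) _.
by rewrite lerD ?dotp_distr // abE distrC dotp_distr.
Qed.

Lemma adjoint_closure A : adjoint (closure A) = adjoint A.
Proof.
apply/seteqP; split=> [p Ap q Aq|p Ap]; first exact/Ap/subset_closure.
move=> [x y] /closure_pairP clxy /=.
apply/eqP; rewrite -subr_eq0; apply/eqP.
apply: (@norm_eps0 _ _ (`|p.1| + `|p.2|)) => [|e e0]; first exact: addr_ge0.
have [a [b [/Ap /= abE xa yb]]] := clxy _ e0.
rewrite -(subrKA (dotp b p.1)) mulrDl; apply: le_trans (ler_normD _ _) _.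
by rewrite lerD ?dotp_distl // abE distrC dotp_distl.
Qed.

Lemma submod_closed_closure (A : set (X * X)) :
  submod_closed [in A] -> submod_closed [in closure A].
Proof.
move=> subA; split=> [|a [x y] [x' y']]; rewrite !inE.
  by apply: subset_closure; exact: (submod0 subA).
move=> /closure_pairP clxy /closure_pairP clxy'; apply/closure_pairP => e e0.
have a1 : 0 < `|a| + 1 by rewrite ltr_wpDl.
pose d := e / (`|a| + 1).
have d0 : 0 < d by rewrite divr_gt0.
have [u [v [Auv xu yv]]] := clxy _ d0; have [u' [v' [Auv' xu' yv']]] := clxy' _ d0.
exists (a *: u + u'), (a *: v + v').
have est (s t s' t' : X) : `|s - t| < d -> `|s' - t'| < d ->
    `|a *: s + s' - (a *: t + t')| < e.
  move=> st st'; rewrite opprD addrACA -scalerBr.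
  apply: le_lt_trans (ler_normD _ _) _; rewrite normrZ.
  have -> : e = `|a| * d + d.
    by rewrite -[X in _ + X]mul1r -mulrDl mulrC divfK // gt_eqF.
  by rewrite ler_ltD // ler_wpM2l // ltW.
by split; [exact: (submodP subA a Auv Auv') | exact: est | exact: est].
Qed.

(** The equation forces closability: if [(x, y)] and [(x, z)] are in the closure, then [(x, - y)]
    and [(x, - z)] are in the adjoint, so [y - z] is orthogonal to the dense domain. *)
Lemma essentially_skew_self_adjointP A :
  submod_closed [in A] -> dense (dom A) ->
  essentially_skew_self_adjoint A <-> adjoint A = opp_operator (closure A).
Proof.
move=> subA denA; split=> [[_ [_ _]]|adjA]; first by rewrite adjoint_closure.
suff clA : linear_operator (closure A).
  split=> //; split=> //; last by rewrite adjoint_closure.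
  move=> O O0 oO; have [x [Ox [p Ap px]]] := denA O O0 oO.
  by exists x; split=> //; exists p => //; exact: subset_closure.
split=> [|x y z Axy Axz]; first exact: submod_closed_closure.
have adj t : closure A (x, t) -> adjoint A (x, - t).
  by rewrite adjA /opp_operator /= opprK.
have {}Axy := adj _ Axy; have {}Axz := adj _ Axz.
apply: dotp_eq => t; apply/eqP; rewrite -subr_eq0 -dotpBr; apply/eqP.
apply: (@norm_eps0 _ _ (`|y - z|)) => // e e0.
have [_ [p Ap <-] tp] := (denseP _).1 denA t e e0.
have pyz : dotp p.1 (y - z) = 0.
  have /= := Axy _ Ap; rewrite (Axz _ Ap) /= !dotpNr => /oppr_inj pzy.
  by rewrite dotpBr pzy subrr.
rewrite -[dotp t _]subr0 -pyz.
exact: dotp_distl.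
Qed.

(** * Reduction by an increasing sequence of projections *)

Section reduction.
Context (A : set (X * X)) (S : nat -> set X) (P : nat -> X -> X).
Hypotheses (subA : submod_closed [in A]) (denA : dense (dom A)).
Hypotheses (subS : forall n, submod_closed [in S n])
  (incS : forall m n, (m <= n)%N -> S m `<=` S n)
  (denS : dense (\bigcup_n S n))
  (projP : forall n, orthogonal_projection (S n) (P n))
  (redA : forall n x y, A (x, y) -> A (P n x, P n y)).

(** By density some [s] in [S N] is close to [x]; for [n >= N] it lies in [S n], and [P n x] is at
    least as close. *)
Lemma proj_cvg x (e : K) : 0 < e ->
  exists N, forall n, (N <= n)%N -> `|x - P n x| < e.
Proof.
move=> e0; have [s [N _ Ns] xs] := (denseP _).1 denS x e e0.
exists N => n Nn; apply: le_lt_trans xs.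
exact: (proj_best (subS n) (projP n)) (incS Nn Ns).
Qed.

(** Recovers the whole from the parts: [(P n x, P n y)] tends to [(x, y)], and a closure is
    closed. *)
Lemma closure_proj (B : set (X * X)) x y :
  (forall n, closure B (P n x, P n y)) -> closure B (x, y).
Proof.
move=> clB; rewrite ((closure_id _).1 (@closed_closure _ B)).
apply/closure_pairP => e e0.
have [N xN] := proj_cvg x e0; have [M yM] := proj_cvg y e0.
exists (P (maxn N M) x), (P (maxn N M) y).
by split=> //; [apply: xN; exact: leq_maxl | apply: yM; exact: leq_maxr].
Qed.

(** Projecting the approximating pairs keeps them in [A] and, [P n] being a contraction, does not
    spoil the approximation. *)
Lemma closure_reduced n x y : closure A (x, y) ->
  closure (A `&` S n `*` S n) (P n x, P n y).
Proof.
move=> /closure_pairP clA; apply/closure_pairP => e e0.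
have [u [v [Auv xu yv]]] := clA _ e0.
exists (P n u), (P n v); split.
- by split; [exact: redA | split; exact: proj_in (projP n) _].
- rewrite -(projB (subS n) (projP n)); apply: le_lt_trans xu.
  exact: (proj_norm (projP n)).
- rewrite -(projB (subS n) (projP n)); apply: le_lt_trans yv.
  exact: (proj_norm (projP n)).
Qed.

Lemma adjoint_reduced n x y : adjoint A (x, y) -> adjoint A (P n x, P n y).
Proof.
move=> adjxy [u v] /(redA n) Auv /=.
by rewrite -!(proj_sym (projP n)) (adjxy _ Auv).
Qed.

(** Localizes the criterion [adjoint A = opp_operator (closure A)] to pairs in [S n], where vectors
    of the completion have preimages under the embedding and the weight is bounded. *)
Lemma essentially_skew_self_adjoint_reduced :
  essentially_skew_self_adjoint A <->
  forall n x y, S n x -> S n y ->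
    (adjoint A (x, y) <-> closure (A `&` S n `*` S n) (x, - y)).
Proof.
rewrite (essentially_skew_self_adjointP subA denA).
split=> [adjA n x y Sx Sy|adjA].
  rewrite adjA; split=> [/(@closure_reduced n) /=|].
    by rewrite (projN (subS n) (projP n)) !(proj_id (subS n) (projP n)).
  by apply: closure_subset => p [].
apply/seteqP; split=> [[x y] adjxy|[x y] /= clxy].
  rewrite /opp_operator /=; apply: closure_proj => n.
  rewrite (projN (subS n) (projP n)).
  suff : closure (A `&` S n `*` S n) (P n x, - P n y).
    by apply: closure_subset => p [].
  apply/adjA; [exact: proj_in (projP n) _ | exact: proj_in (projP n) _ |].
  exact: adjoint_reduced.
(* The adjoint is its own closure, so it too can be tested on the projected pairs. *)
rewrite -closure_adjoint; apply: closure_proj => n; rewrite closure_adjoint.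
apply/adjA; [exact: proj_in (projP n) _ | exact: proj_in (projP n) _ |].
by rewrite -(projN (subS n) (projP n)); exact: closure_reduced.
Qed.

End reduction.

End operators.

(** * Convergence of sequences *)

Section convergence.
Context (R : realType) (F : scalar_kind).
Local Notation K := (scalars R F).

Lemma scalar_conj_ge0 (a : K) : 0 <= a -> scalar_conj R F a = a.
Proof.
move=> a0; have [->|an0] := eqVneq a 0; first exact: rmorph0.
by apply: (mulIf an0); rewrite scalar_conjM ger0_norm.
Qed.

(** A Bernoulli argument: [(1 + (k+1) d) (1 - d) <= 1 + k d] gives [(1 + k d) a_k <= a_0] by
    induction, and [N > a_0 / (d e)] makes [a_0 < (1 + k d) e] for [k >= N]. *)
Lemma geometric_lt (a : nat -> K) (d e : K) : 0 < d -> d <= 1 -> 0 < e ->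
  (forall k, 0 <= a k) -> (forall k, a k.+1 <= (1 - d) * a k) ->
  exists N, forall k, (N <= k)%N -> a k < e.
Proof.
move=> d0 d1 e0 a0 aS.
have bern k : (1 + k%:R * d) * a k <= a 0.
  elim: k => [|k]; first by rewrite mul0r addr0 mul1r.
  apply: le_trans; apply: le_trans (_ : (1 + k.+1%:R * d) * ((1 - d) * a k) <= _).
    by rewrite ler_wpM2l // addr_ge0 // mulr_ge0 // ltW.
  rewrite mulrA ler_wpM2r //.
  have -> : (1 + k.+1%:R * d) * (1 - d) = 1 + k%:R * d - k.+1%:R * d * d.
    by rewrite -natr1; ring.
  by rewrite gerBl !mulr_ge0 // ltW.
have [N aN] : exists N, a 0 / (d * e) < N%:R.
  by apply: scalar_archi; rewrite divr_ge0 // mulr_ge0 // ltW.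
exists N => k Nk; rewrite ltr_pdivrMr ?mulr_gt0 // in aN.
have k0 : 0 < 1 + k%:R * d by rewrite ltr_wpDr // mulr_ge0 // ltW.
rewrite -(ltr_pM2l k0); apply: le_lt_trans (bern k) _; apply: lt_le_trans aN _.
rewrite mulrA; apply: ler_wpM2r; first exact: ltW.
apply: ler_wpDl => //; apply: ler_wpM2r; first exact: ltW.
by rewrite ler_nat.
Qed.

Lemma seq_cvgP (V : normedModType K) (u : nat -> V) (l : V) :
  u @ \oo --> l <->
  forall e : K, 0 < e -> exists N, forall n, (N <= n)%N -> `|l - u n| < e.
Proof.
split=> [/cvgrPdist_lt ul e /ul[N _ uN]|ul]; first by exists N.
by apply/cvgrPdist_lt => e /ul[N uN]; exists N.
Qed.

Lemma cauchy_seq_cvg (V : completeNormedModType K) (u : nat -> V) :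
  (forall e : K, 0 < e -> exists N, forall j k, (N <= j)%N -> (N <= k)%N ->
     `|u j - u k| < e) ->
  exists l : V, u @ \oo --> l.
Proof.
move=> cu; exists (lim (u @ \oo)); apply/cauchy_cvgP/cauchy_exP => e e0.
have [N uN] := cu e e0.
exists (u N); apply: (filterS _ (nbhs_infty_ge N)) => k /= Nk.
by rewrite -ball_normE; exact: uN.
Qed.

End convergence.

(** * The weight on its subspaces [X_n] *)

Section weights.
Context (R : realType) (F : scalar_kind) (X : hilbertType R F).
Local Notation K := (scalars R F).
Context (W : set (X * X)) (Xs : nat -> set X) (P : nat -> X -> X).
Hypotheses (hW : locally_finite_weight W Xs)
  (hP : forall n, orthogonal_projection (Xs n) (P n)).
Local Notation U := (\bigcup_n Xs n).

Lemma weight_submod n : submod_closed [in Xs n].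
Proof. by have [] := lfw_closed_subspace hW n. Qed.

Lemma weight_inj x y z : W (x, y) -> W (x, z) -> y = z.
Proof. by have [[_ +] _ _] := lfw_self_adjoint hW; exact. Qed.

Lemma weight_lin (a : K) x y x' y' : W (x, y) -> W (x', y') ->
  W (a *: x + x', a *: y + y').
Proof.
have [[subW _] _ _] := lfw_self_adjoint hW => Wxy Wxy'.
exact: (submodP subW a Wxy Wxy').
Qed.

Lemma weight_sym x y x' y' : W (x, y) -> W (x', y') -> dotp y x' = dotp x y'.
Proof.
have [_ _ adjW] := lfw_self_adjoint hW; rewrite -[in W (x', y')]adjW.
by move=> Wxy /(_ _ Wxy).
Qed.

(** By [lfw_core] the closure of the restricted weight has dense domain, and the points of that
    domain are limits of points of [U]. *)
Lemma weight_dense : dense U.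
Proof.
apply/denseP => x e e0; have [_ [_ denW _]] := lfw_core hW.
have e20 : 0 < e / 2 by rewrite divr_gt0.
have [_ [[x' y'] /closure_pairP clW <-] /= xx'] := (denseP _).1 denW x _ e20.
have [u [v [[_ /= Uu] xu _]]] := clW _ e20; exists u => //.
by rewrite [e]splitr -(subrKA x'); apply: le_lt_trans (ler_normD _ _) _; exact: ltrD.
Qed.

Lemma weight_submodU : submod_closed [in U].
Proof.
split=> [|a x y]; rewrite !inE.
  by exists 0%N => //; exact: submod0 (weight_submod 0).
move=> [m _ mx] [n _ ny]; exists (maxn m n) => //.
apply: submodP; first exact: weight_submod.
  exact: (lfw_increasing hW (leq_maxl _ _)) mx.
exact: (lfw_increasing hW (leq_maxr _ _)) ny.
Qed.

Lemma weight_fun_ex :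
  {Wf : X -> X | forall n x, Xs n x -> W (x, Wf x) /\ Xs n (Wf x)}.
Proof.
have WfP x : exists y, forall n, Xs n x -> W (x, y) /\ Xs n y; last first.
  by have [Wf WfE] := choice WfP; exists Wf => n x; exact: WfE.
have [[n _ nx]|nU] := pselect (U x); last by exists 0 => n nx; case: nU; exists n.
(* One value serves all [m] with [x] in [X_m], since [W] is single-valued. *)
have [y Wxy _] := lfw_invariant hW nx; exists y => m mx; split=> //.
by have [z Wxz mz] := lfw_invariant hW mx; rewrite (weight_inj Wxy Wxz).
Qed.

(* [W] as a function on [U]; its values outside [U] are irrelevant. *)
Definition weight_fun : X -> X := sval weight_fun_ex.
Local Notation Wf := weight_fun.

Lemma weight_funP n x : Xs n x -> W (x, Wf x).
Proof. by move=> nx; have [] := svalP weight_fun_ex n x nx. Qed.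

Lemma weight_fun_in n x : Xs n x -> Xs n (Wf x).
Proof. by move=> nx; have [] := svalP weight_fun_ex n x nx. Qed.

Lemma weight_fun_lin n (a : K) x y : Xs n x -> Xs n y ->
  Wf (a *: x + y) = a *: Wf x + Wf y.
Proof.
move=> nx ny; apply: weight_inj.
  by apply: (@weight_funP n); apply: submodP => //; exact: weight_submod.
by apply: weight_lin; [exact: weight_funP nx | exact: weight_funP ny].
Qed.

Lemma weight_funB n x y : Xs n x -> Xs n y -> Wf (x - y) = Wf x - Wf y.
Proof.
by move=> nx ny; rewrite addrC -scaleN1r (weight_fun_lin _ ny nx) scaleN1r addrC.
Qed.

Lemma weight_fun_sym n x y z : Xs n x -> W (y, z) -> dotp y (Wf x) = dotp z x.
Proof. by move=> nx Wyz; rewrite (weight_sym Wyz (weight_funP nx)). Qed.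

(** For [s] in [X_n] symmetry gives [<y - W (P_n x), s> = <x - P_n x, W s>], which vanishes because
    [W s] is again in [X_n]. *)
Lemma weight_proj n x y : W (x, y) -> Wf (P n x) = P n y.
Proof.
move=> Wxy; apply/esym/(proj_uniq (weight_submod n) (hP n)).
  exact/weight_fun_in/(proj_in (hP n)).
move=> s ns; rewrite dotpBl -(weight_fun_sym ns Wxy).
rewrite -(weight_fun_sym ns (weight_funP (proj_in (hP n) x))).
by rewrite -dotpBl (proj_orth (hP n)) //; exact: weight_fun_in.
Qed.

Lemma weight_bounds n : exists B : K, 1 <= B /\ forall x, Xs n x ->
  [/\ `|Wf x| <= B * `|x|, `|x| <= B * `|Wf x| &
      `|x| ^+ 2 <= B * dotp x (Wf x)].
Proof.
have [M0 WM] := lfw_bounded hW n; have [c c0 Wc] := lfw_positive hW n.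
(* [|M0|] bounds [W], [c^-1] gives coercivity and with it the bound on the inverse, and the summand
   [1] secures [1 <= B]. *)
exists (`|M0| + c^-1 + 1); split; first by rewrite lerDr addr_ge0 // invr_ge0 ltW.
move=> x nx; have Wx := weight_funP nx.
have pos : 0 <= dotp x (Wf x).
  apply: le_trans (Wc _ _ nx Wx).
  by rewrite -sqr_normE mulr_ge0 ?exprn_ge0 // ltW.
have low : `|x| ^+ 2 <= c^-1 * dotp x (Wf x).
  by rewrite mulrC ler_pdivlMr // mulrC sqr_normE; exact: Wc.
split.
- apply: le_trans (WM _ _ nx Wx) _.
  have M0x : 0 <= M0 * `|x| by apply: le_trans (WM _ _ nx Wx).
  rewrite -(ger0_norm M0x) normrM normr_id ler_wpM2r // -addrA lerDl.
  by rewrite addr_ge0 // invr_ge0 ltW.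
- apply: le_norm_of_sqr; first by rewrite mulr_ge0 // !addr_ge0 // invr_ge0 ltW.
  apply: le_trans low _; rewrite mulrCA.
  apply: (@le_trans _ _ (c^-1 * (`|x| * `|Wf x|))).
    rewrite ler_wpM2l ?invr_ge0 ?(ltW c0) //.
    by apply: le_trans (CauchySchwarz_dotp _ _); rewrite ger0_norm.
  by rewrite ler_wpM2r ?mulr_ge0 // -addrA addrCA lerDl addr_ge0.
- apply: le_trans low _; rewrite ler_wpM2r // -addrA addrCA lerDl.
  by rewrite addr_ge0.
Qed.

Lemma weight_cvg n (u : nat -> X) l :
  (forall k, Xs n (u k)) -> u @ \oo --> l -> Xs n l.
Proof.
have [_ clX] := lfw_closed_subspace hW n => nu ul.
exact: (closed_cvg _ clX (nearW _ nu) _ ul).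
Qed.

(* Richardson iteration [x_{k+1} = x_k + t (y - W x_k)] with [t = 1 / B^3]:
   as [|x|^2 <= B <x, W x>] and [|W x| <= B |x|], the squared norm of the
   residual shrinks by the factor [1 - 1 / B^4] at each step. *)
Lemma weight_fun_surj n y : Xs n y -> exists2 x, Xs n x & Wf x = y.
Proof.
move=> ny; have [B [B1 WB]] := weight_bounds n.
have B0 : 0 < B by exact: lt_le_trans B1.
pose t := B^-1 ^+ 3.
have t0 : 0 < t by rewrite exprn_gt0 // invr_gt0.
pose x := fix x k := if k is k'.+1 then x k' + t *: (y - Wf (x k')) else 0.
have [r rE] : exists r : nat -> X, forall k, r k = y - Wf (x k) by eexists.
have nx k : Xs n (x k).
  elim: k => [|k nx]; first exact: submod0 (weight_submod n).
  rewrite /= addrC; apply: submodP => //; first exact: weight_submod.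
  by apply: submodB; [exact: weight_submod | | exact: weight_fun_in].
have nr k : Xs n (r k).
  by rewrite rE; apply: submodB; [exact: weight_submod | | exact: weight_fun_in].
have rS k : r k.+1 = r k - t *: Wf (r k).
  rewrite !rE /= -(rE k) [x k + _]addrC (weight_fun_lin t (nr k) (nx k)).
  by rewrite opprD addrCA addrC -rE.
have rle k : `|r k.+1| ^+ 2 <= (1 - t * B^-1) * `|r k| ^+ 2.
  have [Wr _ rW] := WB _ (nr k).
  rewrite rS sqr_normE !(dotpBl, dotpBr, dotpZl, dotpZr) (scalar_conj_ge0 (ltW t0)).
  rewrite (weight_sym (weight_funP (nr k)) (weight_funP (nr k))) -!sqr_normE.
  set n2 := `|r k| ^+ 2 in rW *; set w := dotp _ _ in rW *.
  have Wr2 : `|Wf (r k)| ^+ 2 <= B ^+ 2 * n2.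
    by rewrite -exprMn lerXn2r ?nnegrE // mulr_ge0 // ltW.
  have rW' : B^-1 * n2 <= w by rewrite mulrC ler_pdivrMr // mulrC.
  (* The bracket on the right vanishes, as [t = B^-3] makes [t B^2 = B^-1]. In this form the two
     sides compare term by term: [w >= B^-1 n2] is used twice, [|W r|^2 <= B^2 n2] once. *)
  have -> : (1 - t * B^-1) * n2 = n2 - t * (B^-1 * n2) -
      (t * (B^-1 * n2) - t * (t * (B ^+ 2 * n2))).
    have -> : t * (t * (B ^+ 2 * n2)) = t * B^-1 * (B^-1 * B) ^+ 2 * n2.
      by rewrite /t; ring.
    by rewrite mulVf ?gt_eqF //; ring.
  apply: lerB; first by rewrite lerD2l lerN2 ler_wpM2l // ltW.
  by apply: lerB; rewrite !ler_wpM2l // ltW.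
have r_small e : 0 < e -> exists N, forall k, (N <= k)%N -> `|r k| < e.
  move=> e0; have tB : 0 < t * B^-1 by rewrite mulr_gt0 ?invr_gt0.
  have tB1 : t * B^-1 <= 1.
    by rewrite -exprSr exprn_ile1 ?invr_ge0 ?invf_le1 // ltW.
  have e20 : 0 < e ^+ 2 by rewrite exprn_gt0.
  have r0 k : 0 <= `|r k| ^+ 2 by rewrite exprn_ge0.
  have [N rN] := geometric_lt tB tB1 e20 r0 rle.
  exists N => k /rN; rewrite ltr_pXn2r ?nnegrE //; exact: ltW.
(* The iterates are Cauchy because [|x_j - x_k| <= B |W (x_j - x_k)| = B |r_k - r_j|]. *)
have [|l xl] := @cauchy_seq_cvg _ _ _ x.
  move=> e e0; have [|N rN] := r_small (e / B / 2); first by rewrite !divr_gt0.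
  exists N => j k Nj Nk.
  have nxx : Xs n (x j - x k) by apply: submodB => //; exact: weight_submod.
  have [_ le _] := WB _ nxx; apply: le_lt_trans le _.
  rewrite mulrC -ltr_pdivlMr // (weight_funB (nx j) (nx k)).
  have -> : Wf (x j) - Wf (x k) = r k - r j by rewrite !rE opprB [RHS]addrC subrKA.
  apply: le_lt_trans (ler_normB _ _) _.
  by rewrite [e / B]splitr ltrD // rN.
have nl : Xs n l := weight_cvg nx xl.
exists l => //; apply/eqP; rewrite -subr_eq0; apply/eqP.
apply: (@norm_eps0 _ _ (B + 1)) => [|e e0]; first by rewrite addr_ge0 // ltW.
have [N rN] := r_small e e0.
have [M xM] := (seq_cvgP _ _).1 xl e e0.
have {}xM := xM _ (leq_maxr N M).
rewrite -(subrKA (Wf (x (maxn N M)))) mulrDl mul1r.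
apply: le_trans (ler_normD _ _) _; apply: lerD; last first.
  by rewrite distrC -rE ltW // rN // leq_maxl.
rewrite -(weight_funB nl (nx _)).
have nlx : Xs n (l - x (maxn N M)) by apply: submodB => //; exact: weight_submod.
have [le _ _] := WB _ nlx; apply: le_trans le _.
by rewrite ler_wpM2l // ltW.
Qed.

End weights.

(** * The embedding into the completion and its projections *)

Section weighted_spaces.
Context (R : realType) (F : scalar_kind) (X XW : hilbertType R F).
Local Notation K := (scalars R F).
Context (W : set (X * X)) (Xs : nat -> set X) (P : nat -> X -> X)
  (J : X -> XW) (H : set (X * X)).
Hypotheses (hW : locally_finite_weight W Xs)
  (hP : forall n, orthogonal_projection (Xs n) (P n))
  (hXW : is_completion W (\bigcup_n Xs n) J).
Local Notation U := (\bigcup_n Xs n).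
Local Notation Wf := (weight_fun hW).

Let subX n : submod_closed [in Xs n] := weight_submod hW n.
Let subU : submod_closed [in U] := weight_submodU hW.
Let UX n x : Xs n x -> U x. Proof. by move=> nx; exists n. Qed.
Let PX n x : Xs n (P n x) := proj_in (hP n) x.

Lemma embedding0 : J 0 = 0.
Proof.
have := completion_linear hXW (-1) (submod0 subU) (submod0 subU).
by rewrite scaler0 addr0 scaleN1r addNr.
Qed.

Lemma embeddingN x : U x -> J (- x) = - J x.
Proof.
move=> Ux; have := completion_linear hXW (-1) Ux (submod0 subU).
by rewrite !addr0 embedding0 addr0 !scaleN1r.
Qed.

Lemma embeddingB x y : U x -> U y -> J (x - y) = J x - J y.
Proof.
move=> Ux Uy; rewrite addrC -scaleN1r (completion_linear hXW) // scaleN1r.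
by rewrite addrC.
Qed.

Lemma embedding_dotp n x y : U x -> Xs n y -> dotp (J x) (J y) = dotp x (Wf y).
Proof.
move=> Ux ny; apply: (completion_isometry hXW) => //; first exact: UX ny.
exact: weight_funP ny.
Qed.

(** All three norms are equivalent on [X_n], since [|J x|^2 = <x, W x>] is controlled by
    [weight_bounds]. *)
Lemma embedding_bounds n : exists2 B : K, 0 < B & forall x, Xs n x ->
  [/\ `|J x| <= B * `|x|, `|x| <= B * `|J x|,
      `|J x| <= B * `|Wf x| & `|Wf x| <= B * `|J x|].
Proof.
have [B [B1 WB]] := weight_bounds hW n.
have B0 : 0 < B by exact: lt_le_trans B1.
have le_sqr (s t : K) : 0 <= s -> 0 <= t -> s ^+ 2 <= B * t ^+ 2 -> s <= B * t.
  move=> s0 t0 st; rewrite -(@ler_pXn2r _ 2) ?nnegrE // ?mulr_ge0 // ?(ltW B0) //.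
  apply: le_trans st _; rewrite exprMn ler_wpM2r ?exprn_ge0 //.
  by rewrite expr2 ler_peMl // ltW.
have B2 : B <= B ^+ 2 by rewrite expr2 ler_peMl // ltW.
(* Comparing [|J x|] with [|W x|] goes through [|x|] and costs one factor [B] each time. *)
exists (B ^+ 2) => [|x nx]; first by rewrite exprn_gt0.
have [Wx xW xWx] := WB x nx.
have JxE : `|J x| ^+ 2 = dotp x (Wf x).
  by rewrite sqr_normE (embedding_dotp (UX nx) nx).
have Jx : `|J x| <= B * `|x|.
  apply: le_sqr => //; rewrite JxE.
  apply: (@le_trans _ _ (`|x| * `|Wf x|)).
    apply: le_trans (CauchySchwarz_dotp _ _).
    by rewrite ger0_norm // -JxE exprn_ge0.
  by rewrite expr2 mulrCA ler_wpM2l.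
have xJ : `|x| <= B * `|J x| by apply: le_sqr => //; rewrite JxE.
split.
- by apply: le_trans Jx _; rewrite ler_wpM2r.
- by apply: le_trans xJ _; rewrite ler_wpM2r.
- by apply: le_trans Jx _; rewrite expr2 -mulrA ler_wpM2l // ltW.
- by apply: le_trans Wx _; rewrite expr2 -mulrA ler_wpM2l // ltW.
Qed.

Local Notation JX n := (J @` Xs n).

Lemma embedding_submod n : submod_closed [in JX n].
Proof.
split=> [|a xi eta]; rewrite !inE.
  by exists 0; [exact: submod0 | exact: embedding0].
move=> [x nx xE] [y ny yE]; exists (a *: x + y); first exact: submodP.
by rewrite (completion_linear hXW) ?xE ?yE //; [exact: UX nx | exact: UX ny].
Qed.

Lemma embedding_incr m n : (m <= n)%N -> JX m `<=` JX n.
Proof. by move=> mn; exact: image_subset (lfw_increasing hW mn). Qed.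

Lemma embedding_dense : dense (\bigcup_n JX n).
Proof.
move=> O O0 oO; have [xi [Oxi [x [n _ nx] xE]]] := completion_dense hXW O0 oO.
by exists xi; split=> //; exists n => //; exists x.
Qed.

(** Since [W s] lies in [X_n], [<P_n x, W s> = <x, W s>]: on [U], [P n] is orthogonal for the
    weighted inner product as well. *)
Lemma embedding_proj n x s : U x -> Xs n s ->
  dotp (J (P n x)) (J s) = dotp (J x) (J s).
Proof.
move=> Ux ns; rewrite (embedding_dotp Ux ns).
rewrite (embedding_dotp (UX (proj_in (hP n) x)) ns).
by rewrite (dotp_projl (hP n)) //; exact: weight_fun_in.
Qed.

Lemma embedding_proj_norm n x : U x -> `|J (P n x)| <= `|J x|.
Proof.
move=> Ux; have nPx := proj_in (hP n) x.
apply: le_norm_of_sqr => //; rewrite mulrC sqr_normE (embedding_proj Ux nPx).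
apply: le_trans (CauchySchwarz_dotp _ _).
by rewrite -(embedding_proj Ux nPx) real_ler_norm // -sqr_normE realX.
Qed.

(** Choose [u_k] in [U] with [J u_k] tending to [xi]. The [P_n u_k] are Cauchy in the weighted norm,
    hence in [X] by equivalence of norms on [X_n], and [q] is their limit. *)
Lemma weighted_projection_ex n (xi : XW) :
  exists2 q, Xs n q & forall s, Xs n s -> dotp (xi - J q) (J s) = 0.
Proof.
have : forall k, exists x, U x /\ `|xi - J x| < k.+1%:R^-1.
  move=> k; have k0 : 0 < k.+1%:R^-1 :> K by rewrite invr_gt0.
  have [_ [x Ux <-] xix] := (denseP _).1 (completion_dense hXW) xi _ k0.
  by exists x.
move=> /choice[u uP].
have Uu k : U (u k) by have [] := uP k.
have u_cvg (e : K) : 0 < e -> exists N, forall k, (N <= k)%N -> `|xi - J (u k)| < e.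
  move=> e0; have [|N eN] := @scalar_archi R F e^-1; first by rewrite invr_ge0 ltW.
  exists N => k Nk; have [_] := uP k; move=> /lt_trans; apply.
  rewrite invf_plt ?posrE //; apply: lt_le_trans eN _.
  by rewrite ler_nat ltnW.
have [B B0 JB] := embedding_bounds n.
have [|q uq] := @cauchy_seq_cvg _ _ _ (fun k => P n (u k)).
  move=> e e0; have [|N uN] := u_cvg (e / B / 2); first by rewrite !divr_gt0.
  exists N => j k Nj Nk; rewrite -(projB (subX n) (hP n)).
  have [_ le _ _] := JB _ (proj_in (hP n) (u j - u k)).
  apply: le_lt_trans le _; rewrite mulrC -ltr_pdivlMr //.
  apply: le_lt_trans (embedding_proj_norm _ (submodB subU (Uu j) (Uu k))) _.
  rewrite embeddingB // [e / B]splitr -(subrKA xi).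
  apply: le_lt_trans (ler_normD _ _) _; rewrite distrC.
  by rewrite ltrD // uN.
have nq : Xs n q := weight_cvg hW (fun k => proj_in (hP n) (u k)) uq.
exists q => // s ns.
apply: (@norm_eps0 _ _ (`|J s| + `|Wf s|)) => [|e e0]; first exact: addr_ge0.
have [N uN] := u_cvg e e0; have [M qM] := (seq_cvgP _ _).1 uq e e0.
rewrite dotpBl -(subrKA (dotp (J (u (maxn N M))) (J s))) mulrDl.
apply: le_trans (ler_normD _ _) _; apply: lerD.
  by rewrite dotp_distl // uN // leq_maxl.
(* As [<J u_m, J s> = <P_n u_m, W s>], convergence of [P_n u_m] to [q] in [X] is enough. *)
rewrite (embedding_dotp (Uu _) ns) (embedding_dotp (UX nq) ns).
rewrite -(dotp_projl (hP n) _ (weight_fun_in hW ns)) distrC dotp_distl //.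
by rewrite qM // leq_maxr.
Qed.

Lemma weighted_projection_fun :
  exists Q : nat -> XW -> XW, forall n, orthogonal_projection (JX n) (Q n).
Proof.
have /choice[Q QP] : forall n, exists Q : XW -> XW, orthogonal_projection (JX n) Q.
  move=> n; have /choice[Q QP] : forall xi, exists eta : XW,
      JX n eta /\ forall zeta, JX n zeta -> dotp (xi - eta) zeta = 0.
    move=> xi; have [q nq qP] := weighted_projection_ex n xi.
    by exists (J q); split=> [|_ [s ns <-]]; [exists q | exact: qP].
  by exists Q => xi; exact: QP.
by exists Q.
Qed.

(** For [m >= n] the pairing [<J (P_m x), J p>] already equals [<x, W p>], so the limit does too. *)
Lemma represents_dotp n x xi p : represents U J (P ^~ x) xi -> Xs n p ->
  dotp xi (J p) = dotp x (Wf p).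
Proof.
move=> [UP /seq_cvgP Pxi] np; apply/eqP; rewrite -subr_eq0; apply/eqP.
apply: (@norm_eps0 _ _ `|J p|) => // e e0; have [N PN] := Pxi e e0.
pose m := maxn N n.
have mp : Xs m p := lfw_increasing hW (leq_maxr N n) np.
rewrite -(dotp_projl (hP m) x (weight_fun_in hW mp)) -(embedding_dotp (UP m) mp).
by rewrite dotp_distl // PN // leq_maxl.
Qed.

Lemma represents_linear (a : K) x y xi eta :
  represents U J (P ^~ x) xi -> represents U J (P ^~ y) eta ->
  represents U J (P ^~ (a *: x + y)) (a *: xi + eta).
Proof.
move=> [Ux xxi] [Uy yeta]; split=> [n|]; first exact/UX/(proj_in (hP n)).
have -> : J \o P ^~ (a *: x + y) = (fun n => a *: J (P n x) + J (P n y)).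
  apply/funext => n /=.
  by rewrite (proj_linear (subX n) (hP n)) (completion_linear hXW).
by apply: cvgD => //; apply: cvgZr.
Qed.

Lemma represents_embedding n x : Xs n x -> represents U J (P ^~ x) (J x).
Proof.
move=> nx; split=> [m|]; first exact/UX/(proj_in (hP m)).
apply/seq_cvgP => e e0; exists n => m nm /=.
have mx := lfw_increasing hW nm nx.
by rewrite (proj_id (subX m) (hP m) mx) subrr normr0.
Qed.

(** * The operator [H W] and its comparison with [H] *)

Context (Q : nat -> XW -> XW).
Hypotheses (hQ : forall n, orthogonal_projection (JX n) (Q n))
  (subH : submod_closed [in H]) (funH : forall x y z, H (x, y) -> H (x, z) -> y = z)
  (denH : dense (dom H)) (redH : forall n x y, H (x, y) -> H (P n x, P n y)).
Local Notation HW := (weighted_operator W Xs P H J).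

(** [Q n] extends [P n]: by [represents_dotp], [xi] and [J (P n x)] have the same products with
    [J X_n]. *)
Lemma represents_proj n x xi : represents U J (P ^~ x) xi -> Q n xi = J (P n x).
Proof.
move=> xxi; have nPx := proj_in (hP n) x.
apply: (proj_uniq (embedding_submod n) (hQ n)) => [|_ [s ns <-]].
  by exists (P n x).
rewrite dotpBl (represents_dotp xxi ns) (embedding_dotp (UX nPx) ns).
by rewrite (dotp_projl (hP n)) ?subrr //; exact: weight_fun_in.
Qed.

Lemma weighted_operator_embedding n x y : Xs n x -> H (Wf x, y) -> HW (J x, J y).
Proof.
(* [W x] is fixed by [P n], so reduction gives [H (W x, P n y)], and [y = P n y] as [H] is
   single-valued. *)
move=> nx Hxy; have ny : Xs n y.
  have := redH n Hxy; rewrite (proj_id (subX n) (hP n) (weight_fun_in hW nx)).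
  by move=> /(funH Hxy) ->; exact: PX.
exists x, y.
split; [|exact: represents_embedding nx | exact: represents_embedding ny].
by exists (Wf x) => //; exact: weight_funP nx.
Qed.

Lemma weighted_operator_red n xi eta : HW (xi, eta) ->
  exists x y, [/\ Xs n x, Xs n y, H (Wf x, y), Q n xi = J x & Q n eta = J y].
Proof.
move=> [x [y [[z /= Wxz Hzy] xxi yeta]]]; exists (P n x), (P n y).
split; [exact: PX | exact: PX | | exact: represents_proj xxi |
        exact: represents_proj yeta].
by rewrite (weight_proj hW hP n Wxz); exact: redH Hzy.
Qed.

Lemma weighted_operator_submod : submod_closed [in HW].
Proof.
have [[subW _] _ _] := lfw_self_adjoint hW.
split=> [|a [xi eta] [xi' eta']]; rewrite !inE.
  have W0 : Wf 0 = 0.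
    exact: (weight_inj hW (weight_funP hW (submod0 (subX 0))) (submod0 subW)).
  have := @weighted_operator_embedding 0 _ 0 (submod0 (subX 0)).
  by rewrite W0 embedding0; apply; exact: (submod0 subH).
move=> [x [y [[z /= Wxz Hzy] xxi yeta]]] [x' [y' [[z' /= Wxz' Hzy'] xxi' yeta']]].
exists (a *: x + x'), (a *: y + y').
split; [|exact: represents_linear xxi xxi' | exact: represents_linear yeta yeta'].
exists (a *: z + z'); first exact: (submodP subW a Wxz Wxz').
exact: (submodP subH a Hzy Hzy').
Qed.

(** Approximate [xi] by [J p] with [p] in [X_n], then [W p] by [u] in the domain of [H], and solve
    [W x = P_n u] in [X_n]; then [|J p - J x| <= B |W p - P_n u| <= B |W p - u|]. *)
Lemma weighted_operator_dense : dense (dom HW).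
Proof.
apply/denseP => xi e e0; have e20 : 0 < e / 2 by rewrite divr_gt0.
have [_ [p [n _ np] <-] xip] := (denseP _).1 (completion_dense hXW) xi _ e20.
have [B B0 JB] := embedding_bounds n.
have [|_ [[u v] Huv <-] /= pu] := (denseP _).1 denH (Wf p) (e / 2 / B).
  by rewrite divr_gt0.
have [x nx xE] := weight_fun_surj hW (proj_in (hP n) u).
exists (J x); first exists (J x, J (P n v)) => //.
  by apply: weighted_operator_embedding nx _; rewrite xE; exact: redH.
rewrite [e]splitr -(subrKA (J p)); apply: le_lt_trans (ler_normD _ _) _.
apply: ltrD => //; rewrite -(embeddingB (UX np) (UX nx)).
have [_ _ le _] := JB _ (submodB (subX n) np nx); apply: le_lt_trans le _.
rewrite mulrC -ltr_pdivlMr //; apply: le_lt_trans pu.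
rewrite (weight_funB hW np nx) xE.
rewrite -{1}(proj_id (subX n) (hP n) (weight_fun_in hW np)).
by rewrite -(projB (subX n) (hP n)); exact: proj_norm.
Qed.

Lemma adjoint_weighted_operator n p q : Xs n p -> Xs n q ->
  adjoint HW (J p, J q) <-> adjoint H (Wf p, q).
Proof.
move=> np nq; split=> [adjHW [u v] Huv /=|adjH [xi eta] /=]; last first.
  move=> [x [y [[z /= Wxz Hzy] xxi yeta]]] /=.
  rewrite (represents_dotp yeta np) (represents_dotp xxi nq).
  by rewrite (weight_fun_sym hW nq Wxz); exact: (adjH _ Hzy).
(* [W p] and [q] lie in [X_n], so [(u, v)] may be replaced by [(P_n u, P_n v)], which comes from the
   graph of [H W]. *)
have [x nx xE] := weight_fun_surj hW (proj_in (hP n) u).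
have HxPv : H (Wf x, P n v) by rewrite xE; exact: redH.
have := adjHW _ (weighted_operator_embedding nx HxPv) => /=.
rewrite (embedding_dotp (UX (proj_in (hP n) v)) np) (embedding_dotp (UX nx) nq).
rewrite (weight_fun_sym hW nq (weight_funP hW nx)) xE.
by rewrite !(dotp_projl (hP n)) //; exact: weight_fun_in.
Qed.

(** [J x |-> W x] and [J y |-> y] are linear bijections of [J X_n] onto [X_n], bounded by [B] in
    both directions, so an approximation within [e / B] on one side yields one within [e] on the
    other. *)
Lemma closure_weighted_operator n p q : Xs n p -> Xs n q ->
  closure (HW `&` JX n `*` JX n) (J p, J q) <->
  closure (H `&` Xs n `*` Xs n) (Wf p, q).
Proof.
move=> np nq; have [B B0 JB] := embedding_bounds n.
have shrink (e : K) : 0 < e -> 0 < e / B by move=> e0; rewrite divr_gt0.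
split=> /closure_pairP cl; apply/closure_pairP => e e0.
  have [xi [eta [[HWxi [/= nxi neta]] pxi qeta]]] := cl _ (shrink _ e0).
  have [x [y [nx ny Hxy xE yE]]] := weighted_operator_red n HWxi.
  rewrite (proj_id (embedding_submod n) (hQ n) nxi) in xE.
  rewrite (proj_id (embedding_submod n) (hQ n) neta) in yE.
  exists (Wf x), y; split.
  - by split=> //; split=> //=; exact: weight_fun_in.
  - rewrite -(weight_funB hW np nx).
    have [_ _ _ le] := JB _ (submodB (subX n) np nx); apply: le_lt_trans le _.
    by rewrite mulrC -ltr_pdivlMr // (embeddingB (UX np) (UX nx)) -xE.
  - have [_ le _ _] := JB _ (submodB (subX n) nq ny); apply: le_lt_trans le _.
    by rewrite mulrC -ltr_pdivlMr // (embeddingB (UX nq) (UX ny)) -yE.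
have [u [y [[Huy [/= nu ny]] pu qy]]] := cl _ (shrink _ e0).
have [x nx xE] := weight_fun_surj hW nu.
exists (J x), (J y); split.
- split; first by apply: weighted_operator_embedding nx _; rewrite xE.
  by split=> /=; [exists x | exists y].
- rewrite -(embeddingB (UX np) (UX nx)).
  have [_ _ le _] := JB _ (submodB (subX n) np nx); apply: le_lt_trans le _.
  by rewrite mulrC -ltr_pdivlMr // (weight_funB hW np nx) xE.
- rewrite -(embeddingB (UX nq) (UX ny)).
  have [le _ _ _] := JB _ (submodB (subX n) nq ny); apply: le_lt_trans le _.
  by rewrite mulrC -ltr_pdivlMr.
Qed.

Lemma weighted_operator_essentially_skew_self_adjoint :
  essentially_skew_self_adjoint H <-> essentially_skew_self_adjoint HW.
Proof.
have redHW n xi eta : HW (xi, eta) -> HW (Q n xi, Q n eta).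
  move=> /(weighted_operator_red n)[x [y [nx ny Hxy -> ->]]].
  exact: weighted_operator_embedding nx Hxy.
rewrite (essentially_skew_self_adjoint_reduced subH denH subX
  (lfw_increasing hW) (weight_dense hW) hP redH).
rewrite (essentially_skew_self_adjoint_reduced weighted_operator_submod
  weighted_operator_dense embedding_submod embedding_incr embedding_dense hQ redHW).
split=> [sH n _ _ [p np <-] [q nq <-]|sHW n u q nu nq].
  rewrite -(embeddingN (UX nq)) (adjoint_weighted_operator np nq).
  rewrite (closure_weighted_operator np (submodN (subX n) nq)).
  exact: sH (weight_fun_in hW np) nq.
have [p np <-] := weight_fun_surj hW nu.
rewrite -(adjoint_weighted_operator np nq).
rewrite -(closure_weighted_operator np (submodN (subX n) nq)) (embeddingN (UX nq)).
by apply: sHW; [exists p | exists q].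
Qed.

End weighted_spaces.

Theorem corollary4p14 (R : realType) (F : scalar_kind) (X : hilbertType R F)
    (W : set (X * X)) (Xs : nat -> set X) (P : nat -> X -> X)
    (XW : hilbertType R F) (J : X -> XW) (H : set (X * X))
    (hW : locally_finite_weight W Xs)
    (hP : forall n, orthogonal_projection (Xs n) (P n))
    (hXW : is_completion W (\bigcup_n Xs n) J)
    (hH : linear_operator H)
    (hHdense : dense (dom H))
    (hPH : forall n, (graph (P n) \; H)%relation `<=`
                     (H \; graph (P n))%relation) :
  essentially_skew_self_adjoint H <->
  essentially_skew_self_adjoint (weighted_operator W Xs P H J).
Proof.
have [subH funH] := hH.
have redH n x y : H (x, y) -> H (P n x, P n y).
  (* The composition [\;] applies its right factor first, so [hPH] is the inclusion of [P_n H] in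
     [H P_n], here at [(x, P n y)]. *)
  move=> Hxy; have [|z /= [w _ [-> <-]]] := hPH n (x, P n y); last by [].
  by exists y => //; exists y.
have [Q hQ] := weighted_projection_fun hW hP hXW.
exact: (weighted_operator_essentially_skew_self_adjoint
  hW hP hXW hQ subH funH hHdense redH).
Qed.
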